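(* There exists a continuous $1$-periodic function $f:\mathbb{R}\to\mathbb{R}$ which is not of bounded variation on $[0,1]$ such that for every irrational $\theta\in\mathbb{R}$ and every $\varphi\in\mathbb{R}$, $$\liminf_{Q\to\infty}\left|\sum_{k=0}^{Q-1} f(k\theta+\varphi)\right| = 0 .$$ *)

(* Defs.v *)
From mathcomp Require Import all_boot all_order all_algebra.
From mathcomp Require Import all_classical all_reals all_analysis.

(* Main.v *)
Require Import Defs.
From mathcomp Require Import all_boot all_order all_algebra.
From mathcomp Require Import all_classical all_reals all_analysis.
From mathcomp Require Import ring lra zify.
Import Order.TTheory GRing.Theory Num.Theory.
Import numFieldNormedType.Exports.
Local Open Scope classical_set_scope.
Local Open Scope ring_scope.

Set Implicit Arguments.
Unset Strict Implicit.

(**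
The function is f(x) = sum_i c_i / m_i cos(2 pi m_i x), with c_i = 1 / sqrt(i + 1)
and the super-lacunary frequencies m_i = 4^(2^i), so that m_(i+1) = m_i^2.

Birkhoff sums. The Q-th Birkhoff sum of the i-th term is at most
c_i |sin(pi Q theta)| / |sin(pi m_i theta)| and at most Q c_i / m_i. For every
irrational theta there are infinitely many j such that all q <= m_j satisfy
||q theta|| >= 1 / (2 m_(j+1)). For such j let Q be the least positive integer with
||Q theta|| <= 1 / m_(j+1)^2; then Q <= m_(j+1)^2 by Dirichlet. The terms i <= j
contribute O(j / m_(j+1)) by the first bound. Since Q is a best approximation, the
terms i = j+1, j+2 contribute O(c_i) each, as in the Denjoy-Koksma inequality. The
terms i > j+2 contribute O(Q / m_(j+3)). Everything tends to 0.

Variation. On the grid of step 1 / (4 m_j) the terms i > j are constant, and the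
increments of the others form a sum of sines which behave like independent random
variables: a shift by a quarter period of the i-th sine leaves all later sines
invariant. Hence the fourth moment of the increments is at most 3 times the square of
the second one, so their first moment is comparable to the square root of the second
moment, that is, of sum_(i <= j) c_i^2, which diverges.
*)

(** * Sine sums and the distance to the nearest integer *)

Section sine_bounds.
Context {R : realType}.
Implicit Types x a b : R.

Lemma norm_sinMn (n : nat) x : `|sin (n%:R * x)| <= n%:R * `|sin x|.
Proof.
elim: n => [|n IH]; first by rewrite !mul0r sin0 normr0.
rewrite -natr1 !mulrDl !mul1r sinD (le_trans (ler_normD _ _))// lerD//.
  by rewrite normrM (le_trans _ IH)// ler_piMr// cos_max.
by rewrite normrM ler_piMl// cos_max.
Qed.

Lemma norm_sinDpin (n : nat) x : `|sin (x + n%:R * pi)| = `|sin x|.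
Proof. by rewrite mulr_natl (alternatingn (@sinDpi R)) normrM normrX normrN1 expr1n mul1r. Qed.

Lemma norm_sinDpiz (p : int) x : `|sin (x + p%:~R * pi)| = `|sin x|.
Proof.
case: p => n; first exact: norm_sinDpin.
by rewrite NegzE mulrNz mulNr -(norm_sinDpin n.+1 (x - _)) subrK.
Qed.

Lemma sum_cos_arith a b (Q : nat) :
  (\sum_(k < Q) cos (k%:R * (a * 2) + b)) * sin a =
  sin (Q%:R * a) * cos (Q%:R * a - a + b).
Proof.
elim: Q => [|Q IH]; first by rewrite big_ord0 !mul0r sin0 mul0r.
rewrite big_ord_recr/= mulrDl IH -[in RHS]natr1.
set s := Q%:R * a; set u := s + b.
have -> : s - a + b = u - a by rewrite /u; ring.
have -> : Q%:R * (a * 2) + b = u + s by rewrite /u /s; ring.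
have -> : (Q%:R + 1) * a = s + a by rewrite /s; ring.
have -> : s + a - a + b = u by rewrite /u; ring.
by clearbody u; rewrite cosB cosD sinD; ring.
Qed.

Lemma cos_sqr_piquarter : cos (pi / 4 : R) ^+ 2 = 1 / 2.
Proof.
have := cos_mulr2n (pi / 4 : R).
have -> : (pi / 4 : R) *+ 2 = pi / 2 by rewrite mulr2n; lra.
by rewrite cos_pihalf mulr2n; lra.
Qed.

Lemma sin_mvt x : 0 <= x -> exists2 c, 0 <= c <= x & sin x = cos c * x.
Proof.
move=> x0.
have [c cx] : exists2 c, c \in `[0, x] & sin x - sin 0 = cos c * (x - 0).
  apply: MVT_segment => //.
  by apply/continuous_subspaceT => y; exact: continuous_sin.
by rewrite sin0 !subr0 => ->; exists c => //; move: cx; rewrite in_itv.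
Qed.

(** Halve the angle: the mean value theorem writes [sin (x / 2)] as [cos c * (x / 2)], and both
    [cos c] and [cos (x / 2)] are at least [cos (pi / 4)], whose square is 1/2. *)
Lemma sin_ge_half x : 0 <= x <= pi / 2 -> x / 2 <= sin x.
Proof.
move=> /andP[x0 xpi].
have cosge c : 0 <= c <= pi / 4 -> cos (pi / 4) <= cos c.
  move=> /andP[c0 c4]; have pi0 := @pi_gt0 R.
  rewrite leNgt; apply/negP => h.
  have : (cos c < cos (pi / 4)) = (pi / 4 < c).
    by apply: ltr_cos; rewrite in_itv/=; lra.
  by rewrite h => /esym; lra.
have cos4 : 0 <= cos (pi / 4 : R).
  by apply: cos_ge0_pihalf; have pi0 := @pi_gt0 R; lra.
have x2 : 0 <= x / 2 by lra.
have [c /andP[c0 cx] sx] := sin_mvt x2.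
have -> : x = (x / 2) *+ 2 by rewrite mulr2n; lra.
rewrite sin_mulr2n sx mulr2n.
have h1 : cos (pi / 4) <= cos c by apply: cosge; lra.
have h2 : cos (pi / 4) <= cos (x / 2) by apply: cosge; lra.
have := ler_pM cos4 cos4 h1 h2; rewrite -expr2 cos_sqr_piquarter => h3.
rewrite -mulr2n.
have := ler_wpM2r x2 h3; set A := cos c; set B := cos (x / 2); nra.
Qed.

Lemma pi_le4 : pi <= 4 :> R.
Proof. by have := @pihalf_lt2 R; lra. Qed.

Lemma norm_sin_le x : `|sin x| <= `|x|.
Proof.
wlog x0 : x / 0 <= x.
  move=> H; have [/H//|/ltW x0] := leP 0 x.
  by rewrite -normrN -sinN -(normrN x) H// oppr_ge0.
have [c _ ->] := sin_mvt x0.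
by rewrite normrM ler_piMl// cos_max.
Qed.

(** * Distance to the nearest integer, compared with the sine *)

Definition dist_int x : R := `|x - (Num.floor (x + 1 / 2))%:~R|.

Lemma dist_int_le_half x : dist_int x <= 1 / 2.
Proof.
have /andP[] := floor_itv (x + 1 / 2); rewrite intrD /dist_int => h1 h2.
by rewrite ler_norml; lra.
Qed.

(** The chosen integer is within 1/2 of [x], and any other integer is at distance at least 1 from
    it. *)
Lemma dist_int_le x (p : int) : dist_int x <= `|x - p%:~R|.
Proof.
have := dist_int_le_half x; rewrite /dist_int; set r := Num.floor _ => h.
have [->//|rp] := eqVneq p r.
have : (1 : R) <= `|p%:~R - r%:~R|.
  by rewrite -intrB -intr_norm -[1]/(1%:~R) ler_int -gtz0_ge1 normr_gt0 subr_eq0.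
have -> : p%:~R - r%:~R = (x - r%:~R) - (x - p%:~R) :> R by ring.
by have := ler_normB (x - r%:~R) (x - p%:~R); lra.
Qed.

Lemma sin_dist_int x : `|sin (pi * x)| = `|sin (pi * dist_int x)|.
Proof.
rewrite /dist_int; set r := Num.floor _.
have -> : pi * x = pi * (x - r%:~R) + r%:~R * pi by ring.
rewrite norm_sinDpiz.
by have [//|_] := ger0P (x - r%:~R); rewrite mulrN sinN normrN.
Qed.

Lemma dist_int_le_sin x : dist_int x <= `|sin (pi * x)|.
Proof.
rewrite sin_dist_int; have d0 : 0 <= dist_int x by exact: normr_ge0.
have d2 := dist_int_le_half x; have p2 := @pi_ge2 R.
have : 0 <= pi * dist_int x <= pi / 2.
  by apply/andP; split; [rewrite mulr_ge0// pi_ge0|rewrite ler_wpM2l ?pi_ge0//; lra].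
move=> /sin_ge_half h; rewrite (le_trans _ (ler_norm _))// (le_trans _ h)//.
nra.
Qed.

Lemma sin_le_dist_int x : `|sin (pi * x)| <= 4 * dist_int x.
Proof.
rewrite sin_dist_int (le_trans (norm_sin_le _))// normrM ger0_norm ?pi_ge0//.
by rewrite normr_id ler_wpM2r ?pi_le4.
Qed.

(** The numerator of the Dirichlet kernel is the sine of [m] times [pi * (Q%:R * theta)]. The factor
    [m] lost here is cancelled later by the weight of the wave. *)
Lemma sum_cos_rotation (theta phi : R) (m Q : nat) :
  `|\sum_(k < Q) cos (2 * pi * m%:R * (k%:R * theta + phi))| *
    `|sin (pi * (m%:R * theta))| <= m%:R * `|sin (pi * (Q%:R * theta))|.
Proof.
rewrite -normrM.
rewrite (eq_bigr (fun k : 'I_Q =>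
  cos (k%:R * (pi * (m%:R * theta) * 2) + 2 * pi * m%:R * phi))); last first.
  by move=> k _; congr cos; ring.
rewrite sum_cos_arith normrM (le_trans (ler_piMr _ (cos_max _)))//.
rewrite (_ : Q%:R * _ = m%:R * (pi * (Q%:R * theta))); [|ring].
exact: norm_sinMn.
Qed.

End sine_bounds.

(** * Rational approximation *)

Section diophantine.
Context {R : realType}.
Implicit Types theta : R.

Lemma dist_int_gt0 theta (q : nat) :
  irrational theta -> (0 < q)%N -> 0 < dist_int (q%:R * theta).
Proof.
move=> irr q0; rewrite /dist_int normr_gt0 subr_eq0; apply/negP => /eqP E.
apply: irr; apply/rationalP.
exists (Num.floor (q%:R * theta + 1 / 2)), q.
by rewrite -E mulrAC divff ?mul1r// pnatr_eq0 -lt0n.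
Qed.

(** Pigeonhole: the fractional parts [fr 0], ..., [fr N] fall into [N] boxes of length 1/N, and [q]
    is the difference of two indices sharing a box. *)
Lemma dirichlet_approximation theta (N : nat) : (0 < N)%N ->
  exists2 q, (0 < q <= N)%N & dist_int (q%:R * theta) <= N%:R^-1.
Proof.
move=> N0; apply: contrapT => noq.
have N0R : 0 < N%:R :> R by rewrite ltr0n.
pose fr k : R := k%:R * theta - (Num.floor (k%:R * theta))%:~R.
have fr01 k : 0 <= fr k < 1.
  have /andP[] := floor_itv (k%:R * theta); rewrite intrD /fr; lra.
pose g (k : nat) := `|Num.floor (N%:R * fr k)|%N.
have gE k : ((g k)%:R : R) <= N%:R * fr k < (g k)%:R + 1.
  have /andP[f0 _] := fr01 k.
  have F0 : 0 <= N%:R * fr k by rewrite mulr_ge0// ltW.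
  rewrite /g natr_absz ger0_norm ?floor_ge0//.
  by have := floor_itv (N%:R * fr k); rewrite intrD.
suff : (N.+1 <= N)%N by rewrite ltnn.
apply: (@pigeonhole _ _ g); last first.
  move=> _ [k _ <-] /=; have /andP[g1 _] := gE k; have /andP[_ f1] := fr01 k.
  rewrite -(ltr_nat R) (le_lt_trans g1)//.
  by rewrite -[ltRHS]mulr1 ltr_pM2l.
have key k l : (k < l)%N -> (l <= N)%N -> g k <> g l.
  move=> kl lN gkl; apply: noq; exists (l - k)%N.
    by rewrite subn_gt0 kl (leq_trans _ lN)// leq_subr.
  have := gE k; have := gE l; rewrite -gkl => /andP[a1 a2] /andP[b1 b2].
  apply: (le_trans (dist_int_le _ (Num.floor (l%:R * theta) - Num.floor (k%:R * theta)))).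
  rewrite natrB ?(ltnW kl)// intrB.
  have -> : (l%:R - k%:R) * theta - ((Num.floor (l%:R * theta))%:~R -
    (Num.floor (k%:R * theta))%:~R) = fr l - fr k by rewrite /fr; ring.
  rewrite -[leRHS]mul1r ler_pdivlMr// -(gtr0_norm N0R) -normrM ler_norml.
  lra.
move=> k l; rewrite !inE/= !ltnS => kN lN gkl.
by case: (ltngtP k l) => // h; [case: (key k l)|case: (key l k)].
Qed.

Lemma dist_int_argmin theta (n : nat) : (0 < n)%N -> exists2 q, (0 < q <= n)%N &
  forall m, (0 < m <= n)%N -> dist_int (q%:R * theta) <= dist_int (m%:R * theta).
Proof.
elim: n => [//|[_ _|n /(_ isT)[q qn qmin] _]].
  by exists 1%N => // m; case: m => [|[|]].
have [h|h] := leP (dist_int (q%:R * theta)) (dist_int (n.+2%:R * theta)).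
  exists q; first by move/andP: qn => [-> /leqW].
  move=> m /andP[m0]; rewrite leq_eqVlt => /orP[/eqP->//|mn].
  by apply: qmin; rewrite m0.
exists n.+2; first exact: leqnn.
move=> m /andP[m0]; rewrite leq_eqVlt => /orP[/eqP->//|mn].
by rewrite (le_trans (ltW h))// qmin// m0.
Qed.


(* Two approximations [q < q'] of quality better than [1 / (2 n)], with
   [q' <= n], share the same fraction, so the second cannot be the better one. *)
Lemma dist_int_gap theta (q q' n : nat) : (0 < q)%N -> (q < q')%N ->
  (q' <= n)%N -> dist_int (q'%:R * theta) < dist_int (q%:R * theta) ->
  (2 * n%:R)^-1 <= dist_int (q%:R * theta).
Proof.
move=> q0 qq' q'n dd; rewrite leNgt; apply/negP => dlt.
have q0R : 0 < q%:R :> R by rewrite ltr0n.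
have qq'R : q%:R < q'%:R :> R by rewrite ltr_nat.
have q'nR : q'%:R <= n%:R :> R by rewrite ler_nat.
have q'0R : 0 < q'%:R :> R by lra.
have n0R : 0 < n%:R :> R by lra.
move: dd dlt; rewrite /dist_int.
set p' := Num.floor _; set p := Num.floor _.
set u := q%:R * theta - p%:~R; set v := q'%:R * theta - p'%:~R => vu.
rewrite invfM ltr_pdivlMr// => un.
(* This integer is smaller than 1/2 + 1/2 in absolute value, hence zero; then [q * |v| = q' * |u|],
   against [q < q'] and [|v| < |u|]. *)
have E : q'%:R * u - q%:R * v = (q%:Z * p' - q'%:Z * p)%:~R :> R.
  by rewrite intrB !intrM /u /v -!pmulrn; ring.
have : `|(q%:Z * p' - q'%:Z * p)%:~R| < 1 :> R.
  rewrite -E (le_lt_trans (ler_normB _ _))// !normrM (gtr0_norm q0R) (gtr0_norm q'0R).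
  have : q'%:R * `|u| <= n%:R * `|u| by rewrite ler_wpM2r.
  have qn : q%:R <= n%:R :> R by lra.
  have := ler_pM (ltW q0R) (normr_ge0 v) qn (ltW vu).
  rewrite mulrC in un; lra.
rewrite -intr_norm -[1]/(1%:~R) ltr_int; move: E; set z := (q%:Z * p' - q'%:Z * p) => E zlt.
have z0 : z = 0 by clearbody z; lia.
move: E; rewrite z0 => /eqP; rewrite subr_eq0 => /eqP/(congr1 Num.norm).
rewrite !normrM (gtr0_norm q0R) (gtr0_norm q'0R).
have u0 : 0 < `|u| by apply: le_lt_trans vu.
have : q%:R * `|v| < q'%:R * `|u| by exact: (ltr_pM (ltW q0R) (normr_ge0 v) qq'R vu).
by move=> h1 h2; rewrite h2 ltxx in h1.
Qed.

Lemma dist_int_lt_ex theta (e : R) : 0 < e ->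
  exists q, (0 < q)%N && (dist_int (q%:R * theta) < e).
Proof.
move=> e0.
have [N N0 Ne] : exists2 N : nat, (0 < N)%N & N%:R^-1 < e.
  have h : 0 <= e^-1 by rewrite invr_ge0 ltW.
  have hb := archi_boundP h.
  exists (Num.bound e^-1); first by rewrite -(ltr0n R) (le_lt_trans h).
  by rewrite invf_plt// posrE (le_lt_trans h).
have [q /andP[q0 _] hq] := dirichlet_approximation theta N0.
by exists q; rewrite q0 (le_lt_trans hq).
Qed.

(** Let [q] be the best denominator up to [m J], [q'] the first one that beats it, and [j] the first
    level from [J] on with [q' <= m j.+1]. Then [m j < q'], so no denominator up to [m j] beats [q],
    and [dist_int_gap] bounds the quality of [q] from below. *)
Lemma dist_int_lower_bound_level theta (m : nat -> nat) (J : nat) :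
  irrational theta -> (forall j, (j <= m j)%N) -> (0 < m J)%N ->
  exists2 j, (J <= j)%N & forall q, (0 < q <= m j)%N ->
    (2 * (m j.+1)%:R)^-1 <= dist_int (q%:R * theta).
Proof.
move=> irr mge mJ0.
have [q /andP[q0 qJ] qmin] := dist_int_argmin theta mJ0.
have exq' := dist_int_lt_ex theta (dist_int_gt0 irr q0).
case: (ex_minnP exq') => q' /andP[q'0 q'lt] q'min.
have Jq' : (m J < q')%N.
  by rewrite ltnNge; apply/negP => h; have := qmin q'; rewrite q'0 h leNgt q'lt => /(_ isT).
have exj : exists j, (J <= j)%N && (q' <= m j.+1)%N.
  exists (maxn J q'); rewrite leq_maxl/=.
  by rewrite (leq_trans _ (mge _))// leqW// leq_maxr.
case: (ex_minnP exj) => j /andP[Jj q'j] jmin.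
have jq' : (m j < q')%N.
  move: Jj; rewrite leq_eqVlt => /orP[/eqP<-//|]; case: j q'j jmin => // j _ jmin Jj.
  by rewrite ltnNge; apply/negP => h; have := jmin j; rewrite h -ltnS Jj ltnn => /(_ isT).
have dq : (2 * (m j.+1)%:R)^-1 <= dist_int (q%:R * theta).
  by apply: (dist_int_gap q0 (leq_ltn_trans qJ Jq') q'j q'lt).
exists j => // r /andP[r0 rj]; apply: (le_trans dq).
rewrite leNgt; apply/negP => h; have := q'min r; rewrite r0 h => /(_ isT).
by rewrite leqNgt (leq_ltn_trans rj).
Qed.

(** Take the least [Q] of quality 1/N: Dirichlet gives [Q <= N], and every smaller denominator
    misses the threshold that [Q] meets. *)
Lemma best_approximation theta (N : nat) : (0 < N)%N ->
  exists Q, [/\ (0 < Q <= N)%N, dist_int (Q%:R * theta) <= N%:R^-1 &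
    forall q, (0 < q < Q)%N -> dist_int (Q%:R * theta) <= dist_int (q%:R * theta)].
Proof.
move=> N0.
have exQ : exists Q, (0 < Q)%N && (dist_int (Q%:R * theta) <= N%:R^-1).
  by have [q /andP[q0 _] h] := dirichlet_approximation theta N0; exists q; rewrite q0.
case: (ex_minnP exQ) => Q /andP[Q0 QN] Qmin; exists Q; split => //.
  rewrite Q0/=; have [q /andP[q0 qN] h] := dirichlet_approximation theta N0.
  by apply: leq_trans qN; apply: Qmin; rewrite q0.
move=> q /andP[q0 qQ]; apply: (le_trans QN); rewrite leNgt; apply/negP => h.
by have := Qmin q; rewrite q0 (ltW h) leqNgt qQ => /(_ isT).
Qed.

End diophantine.

(** * The lacunary series and its Birkhoff sums *)

Section lacunary_series.
Context {R : realType}.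
Implicit Types x theta phi : R.

(** Squaring at each step makes the tail negligible in Birkhoff sums; base 4 makes [4 * freq l]
    divide every later frequency, so that quarter periods fit a grid. *)
Definition freq (i : nat) : nat := (4 ^ (2 ^ i))%N.

Lemma freqS i : freq i.+1 = (freq i ^ 2)%N.
Proof. by rewrite /freq expnS mulnC expnM. Qed.

Lemma freq_ge_sqr i : (i.+1 ^ 2 <= freq i)%N.
Proof.
rewrite /freq -[4%N]/(2 ^ 2)%N -expnM mulnC expnM leq_exp2r//.
by rewrite (leq_trans (ltn_expl i (ltnSn 1)))// ltnW// ltn_expl.
Qed.

Lemma freq_gt i : (i < freq i)%N.
Proof. by rewrite (leq_trans _ (freq_ge_sqr i))// -mulnn leq_pmulr. Qed.

Lemma freq_gt0 i : (0 < freq i)%N.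
Proof. exact: leq_trans (freq_gt i). Qed.

Lemma freq_gt0R i : 0 < (freq i)%:R :> R.
Proof. by rewrite ltr0n freq_gt0. Qed.

Lemma leq_freq i j : (i <= j)%N -> (freq i <= freq j)%N.
Proof. by move=> ij; rewrite /freq leq_exp2l// leq_exp2l. Qed.

(** Tends to 0, as the Birkhoff sums require, while its squares form the harmonic series, which
    makes the variation infinite. *)
Definition coef (i : nat) : R := (Num.sqrt i.+1%:R)^-1.

Lemma coef_gt0 i : 0 < coef i.
Proof. by rewrite /coef invr_gt0 sqrtr_gt0 ltr0n. Qed.

Lemma coef_sqr i : coef i ^+ 2 = i.+1%:R^-1.
Proof. by rewrite /coef exprVn sqr_sqrtr// ler0n. Qed.

Lemma coef_le i j : (i <= j)%N -> coef j <= coef i.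
Proof.
by move=> ij; rewrite /coef lef_pV2 ?posrE ?sqrtr_gt0 ?ltr0n// ler_wsqrtr// ler_nat.
Qed.

Lemma coef_le1 i : coef i <= 1.
Proof. by rewrite (le_trans (coef_le (leq0n i)))// /coef sqrtr1 invr1. Qed.

Lemma coef_sqr_le i : i.+1%:R^-1 <= coef i.
Proof. by rewrite -coef_sqr expr2 ler_piMr ?coef_le1// ltW// coef_gt0. Qed.

Definition wave (i : nat) x : R :=
  coef i / (freq i)%:R * cos (2 * pi * (freq i)%:R * x).

Definition wave_sum (n : nat) x : R := \sum_(i < n) wave i x.

Definition lacunary x : R := limn (wave_sum ^~ x).

Lemma norm_wave i x : `|wave i x| <= coef i / (freq i)%:R.
Proof.
rewrite /wave normrM ger0_norm ?divr_ge0 ?ler0n ?(ltW (coef_gt0 i))//.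
by rewrite ler_piMr ?cos_max// divr_ge0 ?ler0n ?(ltW (coef_gt0 i)).
Qed.

Lemma wave_sum_dist n p x : (n <= p)%N ->
  `|wave_sum p x - wave_sum n x| <= 2 / (freq n)%:R.
Proof.
(* The sharper bound telescopes, because frequencies at least double. *)
move=> np; suff : `|wave_sum p x - wave_sum n x| <= 2 / (freq n)%:R - 2 / (freq p)%:R.
  by move=> /le_trans; apply; rewrite gerBl divr_ge0.
elim: p np => [|p IH]; first by rewrite leqn0 => /eqP ->; rewrite !subrr normr0.
rewrite leq_eqVlt => /orP[/eqP <-|]; first by rewrite !subrr normr0.
move=> /IH{}IH.
have -> : wave_sum p.+1 x - wave_sum n x =
  (wave_sum p x - wave_sum n x) + wave p x by rewrite /wave_sum big_ord_recr/=; ring.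
rewrite (le_trans (ler_normD _ _))// (le_trans (lerD IH (norm_wave p x)))//.
have h : coef p / (freq p)%:R <= (freq p)%:R^-1.
  by rewrite ler_piMl ?coef_le1// invr_ge0 ler0n.
have : (freq p.+1)%:R^-1 <= (freq p)%:R^-1 / 2 :> R.
  rewrite -invfM lef_pV2 ?posrE ?mulr_gt0 ?freq_gt0R// freqS natrX expr2.
  rewrite ler_wpM2l ?ler0n// ler_nat /freq.
  by rewrite (@leq_trans (4 ^ 1))// leq_exp2l// expn_gt0.
lra.
Qed.

Lemma freq_inv_small (e : R) : 0 < e -> exists n, 2 / (freq n)%:R < e.
Proof.
move=> e0; have h : 0 <= 2 / e by rewrite divr_ge0// ltW.
exists (Num.bound (2 / e)).
rewrite ltr_pdivrMr ?freq_gt0R// mulrC -ltr_pdivrMr//.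
by rewrite (lt_trans (archi_boundP h))// ltr_nat freq_gt.
Qed.

Lemma is_cvg_wave_sum x : cvgn (wave_sum ^~ x).
Proof.
apply: cauchy_cvg; apply: cauchy_exP => e e0.
have [n ne] := freq_inv_small e0.
exists (wave_sum n x); exists n => // p /= np.
by rewrite /ball/= distrC (le_lt_trans (wave_sum_dist x np)).
Qed.

Lemma lacunary_dist n x : `|lacunary x - wave_sum n x| <= 2 / (freq n)%:R.
Proof.
have near_le : \forall p \near \oo, `|wave_sum p x - wave_sum n x| <= 2 / (freq n)%:R.
  by exists n => // p /= np; exact: wave_sum_dist.
have h1 : wave_sum n x - 2 / (freq n)%:R <= lacunary x.
  apply: limr_ge; first exact: is_cvg_wave_sum.
  by apply: filterS near_le => p; rewrite ler_norml; lra.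
have h2 : lacunary x <= wave_sum n x + 2 / (freq n)%:R.
  apply: limr_le; first exact: is_cvg_wave_sum.
  by apply: filterS near_le => p; rewrite ler_norml; lra.
by rewrite ler_norml; lra.
Qed.

Lemma continuous_wave i : continuous (wave i).
Proof.
move=> x; apply: cvgM; first exact: cvg_cst.
apply: (@continuous_comp _ _ _ (fun x => 2 * pi * (freq i)%:R * x) cos).
  by apply: cvgM; [exact: cvg_cst|exact: cvg_id].
exact: continuous_cos.
Qed.

Lemma continuous_wave_sum n : continuous (wave_sum n).
Proof.
elim: n => [|n IH] x.
  rewrite (_ : wave_sum 0 = cst 0); first exact: cvg_cst.
  by apply/funext => y; rewrite /wave_sum big_ord0.
rewrite (_ : wave_sum n.+1 = wave_sum n \+ wave n).
  by apply: cvgD; [exact: IH|exact: continuous_wave].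
by apply/funext => y; rewrite /wave_sum big_ord_recr.
Qed.

Lemma continuous_lacunary : continuous lacunary.
Proof.
move=> x; apply/cvgrPdist_le => e e0.
have e3 : 0 < e / 3 by rewrite divr_gt0.
have [n ne] := freq_inv_small e3.
have /cvgrPdist_le/(_ _ e3) := @continuous_wave_sum n x.
apply: filterS => y hy.
have := lacunary_dist n x; have := lacunary_dist n y.
have -> : lacunary x - lacunary y = (lacunary x - wave_sum n x) +
  (wave_sum n x - wave_sum n y) - (lacunary y - wave_sum n y) by ring.
move=> h1 h2; rewrite (le_trans (ler_normB _ _))//.
have := ler_normD (lacunary x - wave_sum n x) (wave_sum n x - wave_sum n y).
lra.
Qed.

Lemma cosD2pin (n : nat) x : cos (x + 2 * pi * n%:R) = cos x.
Proof. by rewrite -(periodicn (@cosD2pi R) n x); congr cos; ring. Qed.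

Lemma periodic_lacunary : periodic lacunary 1.
Proof.
move=> x; rewrite /lacunary; congr (limn _); apply/funext => n.
by apply: eq_bigr => i _; rewrite /wave mulrDr mulr1 cosD2pin.
Qed.

Lemma wave_birkhoff theta phi i (Q : nat) :
  `|\sum_(k < Q) wave i (k%:R * theta + phi)| *
    `|sin (pi * ((freq i)%:R * theta))| <= coef i * `|sin (pi * (Q%:R * theta))|.
Proof.
have c0 := coef_gt0 i; have f0 := freq_gt0R i.
rewrite -mulr_sumr normrM ger0_norm ?divr_ge0 ?(ltW c0) ?(ltW f0)//.
set S := `|_|; set s := `|_|.
have -> : coef i / (freq i)%:R * S * s = coef i * (S * s / (freq i)%:R) by ring.
by rewrite ler_wpM2l ?(ltW c0)// ler_pdivrMr// [leRHS]mulrC sum_cos_rotation.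
Qed.

(** If [Q <= freq i], bound each summand by its amplitude. Otherwise [freq i] competes with the best
    denominator [Q], so the quotient of sines in [wave_birkhoff] is at most 4. *)
Lemma wave_birkhoff_best theta phi i (Q : nat) : irrational theta ->
  (forall q, (0 < q < Q)%N -> dist_int (Q%:R * theta) <= dist_int (q%:R * theta)) ->
  `|\sum_(k < Q) wave i (k%:R * theta + phi)| <= 4 * coef i.
Proof.
move=> irr best; have c0 := coef_gt0 i; have [Qi|iQ] := leqP Q (freq i).
  rewrite (le_trans (ler_norm_sum _ _ _))//.
  apply: (@le_trans _ _ (\sum_(k < Q) coef i / (freq i)%:R)).
    by apply: ler_sum => k _; exact: norm_wave.
  rewrite sumr_const card_ord -[_ *+ Q]mulr_natr mulrAC ler_pdivrMr ?freq_gt0R//.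
  rewrite [leRHS]mulrAC mulrC ler_wpM2r ?(ltW c0)//.
  by rewrite -natrM ler_nat (leq_trans Qi)// leq_pmull.
have d0 := dist_int_gt0 irr (freq_gt0 i).
have s0 := dist_int_le_sin ((freq i)%:R * theta).
have := best (freq i); rewrite freq_gt0 iQ => /(_ isT) h.
have sQ := sin_le_dist_int (Q%:R * theta).
rewrite -(ler_pM2r (lt_le_trans d0 s0)) (le_trans (wave_birkhoff _ _ _ _))//.
by rewrite mulrAC mulrC ler_wpM2r ?(ltW c0)//; lra.
Qed.

Lemma wave_birkhoff_low theta phi i (Q N : nat) : (0 < N)%N ->
  (2 * N%:R)^-1 <= dist_int ((freq i)%:R * theta) ->
  dist_int (Q%:R * theta) <= (N%:R ^+ 2)^-1 ->
  `|\sum_(k < Q) wave i (k%:R * theta + phi)| <= 8 / N%:R.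
Proof.
move=> N0 hi hQ; have N0R : 0 < N%:R :> R by rewrite ltr0n.
have s0 := le_trans hi (dist_int_le_sin _).
have d0 : 0 < (2 * N%:R)^-1 :> R by rewrite invr_gt0 mulr_gt0.
have sQ := le_trans (sin_le_dist_int (Q%:R * theta)) (ler_wpM2l (ler0n _ 4) hQ).
rewrite -(ler_pM2r (lt_le_trans d0 s0)) (le_trans (wave_birkhoff _ _ _ _))//.
apply: (@le_trans _ _ (4 / N%:R ^+ 2)).
  by rewrite (le_trans _ sQ)// ler_piMl// coef_le1.
rewrite (le_trans _ (ler_wpM2l _ s0))// ?divr_ge0// le_eqVlt; apply/orP; left.
by apply/eqP; field; rewrite gt_eqF.
Qed.

(** The constant is 8 + 4 + 4 + 2: the waves up to [j], the waves [j.+1] and [j.+2], and the tail,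
    each measured against [coef j.+1]. *)
Lemma lacunary_birkhoff_small theta phi (J : nat) : irrational theta ->
  exists2 Q, (J <= Q)%N &
    `|\sum_(0 <= k < Q) lacunary (k%:R * theta + phi)| <= 18 * coef J.
Proof.
move=> irr.
have [j Jj low] := dist_int_lower_bound_level irr (fun j => ltnW (freq_gt j)) (freq_gt0 J).
set M := freq j.+1 in low.
have M0 : (0 < M)%N by exact: freq_gt0.
have M0R : 0 < M%:R :> R by rewrite ltr0n.
have M2 : (0 < M ^ 2)%N by rewrite expn_gt0 M0.
have [Q [/andP[Q0 QM] QM2 best]] := best_approximation theta M2.
rewrite natrX in QM2.
have M4 : 4 <= M%:R :> R.
  rewrite ler_nat; apply: leq_trans (freq_ge_sqr _).
  by rewrite (@leq_trans (2 ^ 2))// leq_exp2r.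
(* Otherwise [low] applies to [Q] itself and gives [1 / (2 M) <= 1 / M^2], impossible for [M >= 4].
   This is what makes [Q] large. *)
have jQ : (freq j < Q)%N.
  rewrite ltnNge; apply/negP => Qj; have := low Q; rewrite Q0 Qj => /(_ isT) h.
  have := le_trans h QM2; rewrite lef_pV2 ?posrE ?mulr_gt0 ?exprn_gt0//.
  by rewrite expr2 ler_pM2r//; lra.
exists Q; first by rewrite (leq_trans Jj)// ltnW// (ltn_trans (freq_gt j)).
(* Here [Q <= M^2] while [freq j.+3 = M^4]. *)
have tail : `|\sum_(k < Q) lacunary (k%:R * theta + phi) -
    \sum_(k < Q) wave_sum j.+3 (k%:R * theta + phi)| <= 2 / M%:R.
  rewrite -sumrB (le_trans (ler_norm_sum _ _ _))//.
  apply: (@le_trans _ _ (\sum_(k < Q) 2 / (freq j.+3)%:R)).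
    by apply: ler_sum => k _; exact: lacunary_dist.
  rewrite sumr_const card_ord -[_ *+ Q]mulr_natr mulrAC ler_pdivrMr ?freq_gt0R// mulrAC.
  rewrite ler_pdivlMr// 2!freqS -/M -mulrA ler_wpM2l// -natrM ler_nat.
  rewrite -expnM (@leq_trans (M ^ 2 * M))// ?leq_pmul2r//.
  by rewrite -expnSr leq_exp2l// -(ltr_nat R); lra.
have split_sum : \sum_(k < Q) wave_sum j.+3 (k%:R * theta + phi) =
    \sum_(i < j.+1) (\sum_(k < Q) wave i (k%:R * theta + phi)) +
    (\sum_(k < Q) wave j.+1 (k%:R * theta + phi)) +
    (\sum_(k < Q) wave j.+2 (k%:R * theta + phi)).
  by rewrite /wave_sum exchange_big !big_ord_recr.
have lows : `|\sum_(i < j.+1) (\sum_(k < Q) wave i (k%:R * theta + phi))| <=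
    8 * (j.+1%:R / M%:R).
  rewrite (le_trans (ler_norm_sum _ _ _))//.
  apply: (@le_trans _ _ (\sum_(i < j.+1) 8 / M%:R)).
    apply: ler_sum => i _; apply: wave_birkhoff_low => //.
    by apply: low; rewrite freq_gt0 leq_freq// -ltnS.
  by rewrite sumr_const card_ord -[_ *+ j.+1]mulr_natr mulrAC mulrA.
have mid1 := wave_birkhoff_best phi j.+1 irr best.
have mid2 := wave_birkhoff_best phi j.+2 irr best.
have c2 := coef_le (leqnSn j.+1).
have cJ := coef_le (leqW Jj).
have jM : j.+2%:R / M%:R <= coef j.+1.
  rewrite (le_trans _ (coef_sqr_le _))// ler_pdivrMr// mulrC ler_pdivlMr//.
  by rewrite -expr2 -natrX ler_nat freq_ge_sqr.
have jM1 : j.+1%:R / M%:R <= coef j.+1.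
  by rewrite (le_trans _ jM)// ler_wpM2r ?invr_ge0 ?ler0n// ler_nat.
have jM2 : 1 / M%:R <= coef j.+1.
  by rewrite (le_trans _ jM)// ler_wpM2r ?invr_ge0 ?ler0n// ler1n.
rewrite big_mkord; move: tail; rewrite split_sum.
set S := \sum_(k < Q) lacunary _.
move: lows mid1 mid2; set A := \sum_(i < j.+1) _; set B := \sum_(k < Q) _.
set C := \sum_(k < Q) _ => lows mid1 mid2 tail.
have -> : S = (S - (A + B + C)) + (A + B + C) by ring.
have := ler_normD (S - (A + B + C)) (A + B + C).
have := ler_normD (A + B) C; have := ler_normD A B.
lra.
Qed.

(** * The lower limit of the Birkhoff sums *)

Lemma limn_einf_eq0 (u : nat -> R) : (forall n, 0 <= u n) ->
  (forall e n, 0 < e -> exists2 k, (n <= k)%N & u k <= e) ->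
  limn_einf (fun n => (u n)%:E) = 0%E.
Proof.
move=> u0 usmall; rewrite limn_einf_lim.
rewrite (_ : einfs _ = cst 0%E); first by apply: cvg_lim => //; exact: cvg_cst.
apply/funext => n; rewrite /einfs/=; apply/eqP; rewrite eq_le; apply/andP; split.
  apply/lee_addgt0Pr => e e0; rewrite add0e.
  have [k nk uk] := usmall e n e0.
  apply: (@le_trans _ _ (u k)%:E); last by rewrite lee_fin.
  by apply: ereal_inf_lbound; exists k.
by apply: le_ereal_inf_tmp => _ [k _ <-]; rewrite lee_fin.
Qed.

Lemma coef_small (e : R) : 0 < e -> exists j, coef j <= e.
Proof.
move=> e0; have h : 0 <= e ^- 2 by rewrite invr_ge0 exprn_ge0// ltW.
exists (Num.bound (e ^- 2)).
rewrite -(@ler_pXn2r _ 2)// ?nnegrE ?(ltW (coef_gt0 _)) ?(ltW e0)//.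
rewrite coef_sqr invf_ple ?posrE ?ltr0n ?exprn_gt0//.
by rewrite ltW// (lt_trans (archi_boundP h))// ltr_nat.
Qed.

Lemma lacunary_liminf theta phi : irrational theta ->
  limn_einf (fun Q : nat =>
    (`|\sum_(0 <= k < Q) lacunary (k%:R * theta + phi)|)%:E) = 0%E.
Proof.
move=> irr; apply: limn_einf_eq0 => // e n e0.
have e18 : 0 < e / 18 by rewrite divr_gt0.
have [j cj] := coef_small e18.
(* The index bounds [Q] from below and also selects the coefficient, hence the maximum. *)
have [Q JQ hQ] := lacunary_birkhoff_small phi (maxn n j) irr.
exists Q; first by rewrite (leq_trans _ JQ)// leq_maxl.
have := coef_le (leq_maxr n j); lra.
Qed.

End lacunary_series.

(** * Unbounded variation *)

Section fourth_moment_method.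
Context {R : realType}.
Implicit Types (N s k : nat) (X Y T F S : nat -> R).

Lemma sum_shift N F s : (forall k, F (k + N)%N = F k) ->
  \sum_(k < N) F (k + s)%N = \sum_(k < N) F k.
Proof.
move=> FN; elim: s => [|s <-]; first by apply: eq_bigr => k _; rewrite addn0.
case: N FN => [|N] FN; first by rewrite !big_ord0.
rewrite big_ord_recr [RHS]big_ord_recl/= addrC; congr (_ + _).
  by rewrite add0n addnS -addSn addnC FN.
by apply: eq_bigr => k _; rewrite /bump/= addnS add1n.
Qed.

Lemma sum_antiperiodic_eq0 N F s : (forall k, F (k + N)%N = F k) ->
  (forall k, F (k + s)%N = - F k) -> \sum_(k < N) F k = 0.
Proof.
move=> FN Fs; have := sum_shift s FN.
rewrite (eq_bigr (fun k : 'I_N => - F k)); last by move=> k _; exact: Fs.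
by rewrite sumrN; lra.
Qed.

Section quadrature_step.
(** [X] is the sine being added, [s] its quarter period, [Y] its shift by [s], and [T] the sum of
    the faster sines, which the shift preserves. *)
Variables (N s : nat) (c : R) (X Y T : nat -> R).
Hypotheses (XN : forall k, X (k + N)%N = X k) (TN : forall k, T (k + N)%N = T k).
Hypotheses (Xs : forall k, X (k + s)%N = Y k) (Ys : forall k, Y (k + s)%N = - X k).
Hypotheses (XY : forall k, X k ^+ 2 + Y k ^+ 2 = 1) (Ts : forall k, T (k + s)%N = T k).

(** The half period [s + s] negates [X] and fixes [T]. *)
Lemma sum_odd_eq0 (a b : nat) : odd a -> \sum_(k < N) X k ^+ a * T k ^+ b = 0.
Proof.
move=> oa; apply: (@sum_antiperiodic_eq0 _ (fun k => X k ^+ a * T k ^+ b) (s + s)).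
  by move=> k; rewrite XN TN.
by move=> k; rewrite addnA Xs Ys !Ts exprNn -signr_odd oa expr1 mulN1r mulNr.
Qed.

(** The shift by [s] exchanges the weights [X^2] and [Y^2], which add up to 1. *)
Lemma sum_sqr_mean (b : nat) :
  \sum_(k < N) X k ^+ 2 * T k ^+ b = (\sum_(k < N) T k ^+ b) / 2.
Proof.
have h := @sum_shift N (fun k => X k ^+ 2 * T k ^+ b) s.
have {h} : \sum_(k < N) Y k ^+ 2 * T k ^+ b = \sum_(k < N) X k ^+ 2 * T k ^+ b.
  by rewrite -h; [apply: eq_bigr => k _; rewrite Xs Ts|move=> k; rewrite XN TN].
have : \sum_(k < N) X k ^+ 2 * T k ^+ b + \sum_(k < N) Y k ^+ 2 * T k ^+ b =
    \sum_(k < N) T k ^+ b.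
  by rewrite -big_split/=; apply: eq_bigr => k _; rewrite -mulrDl XY mul1r.
lra.
Qed.

Lemma sum_sqr : \sum_(k < N) X k ^+ 2 = N%:R / 2.
Proof.
have := sum_sqr_mean 0; rewrite (eq_bigr (fun k : 'I_N => X k ^+ 2)) => [->|k _].
  by rewrite (eq_bigr (fun=> 1))// sumr_const card_ord.
by rewrite expr0 mulr1.
Qed.

Lemma second_moment_step : \sum_(k < N) (c * X k + T k) ^+ 2 =
  \sum_(k < N) T k ^+ 2 + c ^+ 2 * (N%:R / 2).
Proof.
have XT : \sum_(k < N) X k * T k = 0 by exact: (@sum_odd_eq0 1 1).
rewrite (eq_bigr (fun k : 'I_N => T k ^+ 2 + c ^+ 2 * X k ^+ 2 +
  (2 * c) * (X k * T k))); last by move=> k _; ring.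
by rewrite !big_split/= -!mulr_sumr XT sum_sqr mulr0 addr0.
Qed.

Lemma fourth_moment_step : \sum_(k < N) (c * X k + T k) ^+ 4 <=
  \sum_(k < N) T k ^+ 4 + 3 * c ^+ 2 * \sum_(k < N) T k ^+ 2 +
  c ^+ 4 * (N%:R / 2).
Proof.
have X4 : \sum_(k < N) X k ^+ 4 <= N%:R / 2.
  rewrite -sum_sqr; apply: ler_sum => k _.
  have := XY k; have := sqr_ge0 (X k); have := sqr_ge0 (Y k).
  rewrite (_ : X k ^+ 4 = X k ^+ 2 * X k ^+ 2); last by ring.
  nra.
have XT3 : \sum_(k < N) X k * T k ^+ 3 = 0 by exact: (@sum_odd_eq0 1 3).
have X3T : \sum_(k < N) X k ^+ 3 * T k = 0 by exact: (@sum_odd_eq0 3 1).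
rewrite (eq_bigr (fun k : 'I_N => T k ^+ 4 + (6 * c ^+ 2) * (X k ^+ 2 * T k ^+ 2) +
  c ^+ 4 * X k ^+ 4 + (4 * c) * (X k * T k ^+ 3) +
  (4 * c ^+ 3) * (X k ^+ 3 * T k))); last by move=> k _; ring.
rewrite !big_split/= -!mulr_sumr XT3 X3T sum_sqr_mean !mulr0 !addr0.
have c4 : 0 <= c ^+ 4 by rewrite -[4%N]/(2 * 2)%N exprM sqr_ge0.
by apply: lerD; [rewrite lerD2l; lra|exact: ler_wpM2l].
Qed.

End quadrature_step.

(** A pointwise substitute for Hölder's inequality: for [|x| > t] the left side is nonpositive, and
    for [|x| <= t] its first term is already at most the right side. *)
Lemma norm_ge_moments (t x : R) : 0 < t -> t ^+ 2 * x ^+ 2 - x ^+ 4 <= t ^+ 3 * `|x|.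
Proof.
move=> t0; have -> : x ^+ 4 = x ^+ 2 * x ^+ 2 by ring.
rewrite -(real_normK (num_real x)); set y := `|x|; have y0 : 0 <= y by exact: normr_ge0.
have [yt|ty] := leP y t.
  have : 0 <= t ^+ 2 * y * (t - y) by rewrite !mulr_ge0 ?sqr_ge0//; lra.
  have : 0 <= y ^+ 2 * y ^+ 2 by rewrite mulr_ge0 ?sqr_ge0.
  lra.
have : 0 <= t ^+ 3 * y by rewrite mulr_ge0// exprn_ge0// ltW.
have : 0 <= y ^+ 2 * ((y - t) * (y + t)).
  by rewrite !mulr_ge0 ?sqr_ge0//; lra.
lra.
Qed.

Lemma first_moment_ge N S : (0 < N)%N ->
  N%:R * \sum_(k < N) S k ^+ 4 <= 3 * (\sum_(k < N) S k ^+ 2) ^+ 2 ->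
  N%:R * \sum_(k < N) S k ^+ 2 <= 64 * (\sum_(k < N) `|S k|) ^+ 2.
Proof.
move=> N0; have N0R : 0 < N%:R :> R by rewrite ltr0n.
have : 0 <= \sum_(k < N) S k ^+ 2 by apply: sumr_ge0 => k _; exact: sqr_ge0.
set A := \sum_(k < N) S k ^+ 2; set L := \sum_(k < N) `|S k|; set D := \sum_(k < N) S k ^+ 4.
have L0 : 0 <= L by apply: sumr_ge0.
rewrite le_eqVlt => /orP[/eqP<-|A0 DA]; first by rewrite mulr0 mulr_ge0// sqr_ge0.
have w0 : 0 < 4 * A / N%:R by rewrite divr_gt0// mulr_gt0.
(* With this [t], [N t^2 A = 4 A^2] exceeds [N D <= 3 A^2] by at least [A^2]. *)
pose t := Num.sqrt (4 * A / N%:R).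
have t0 : 0 < t by rewrite sqrtr_gt0.
have t2 : t ^+ 2 = 4 * A / N%:R by rewrite sqr_sqrtr// ltW.
have t2N : N%:R * t ^+ 2 = 4 * A by rewrite t2; field; rewrite gt_eqF.
have h : t ^+ 2 * A - D <= t ^+ 3 * L.
  by rewrite /A /D /L !mulr_sumr -sumrB; apply: ler_sum => k _; exact: norm_ge_moments.
have h2 : A ^+ 2 <= A * (4 * t * L).
  have := ler_wpM2l (ltW N0R) h.
  have -> : N%:R * (t ^+ 2 * A - D) = (N%:R * t ^+ 2) * A - N%:R * D by ring.
  have -> : N%:R * (t ^+ 3 * L) = (N%:R * t ^+ 2) * (t * L) by ring.
  rewrite t2N; lra.
rewrite expr2 ler_pM2l// in h2.
have h3 : A ^+ 2 <= (4 * t * L) ^+ 2 by rewrite ler_sqr// nnegrE ?(ltW A0)// ltW// (lt_le_trans A0).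
have : N%:R * A ^+ 2 <= A * (64 * L ^+ 2).
  have := ler_wpM2l (ltW N0R) h3.
  have -> : N%:R * (4 * t * L) ^+ 2 = 16 * L ^+ 2 * (N%:R * t ^+ 2) by ring.
  by rewrite t2N; lra.
by rewrite (_ : N%:R * A ^+ 2 = A * (N%:R * A)) ?ler_pM2l//; ring.
Qed.

End fourth_moment_method.

(** * Increments of the series along a grid *)

Section unbounded_variation.
Context {R : realType}.

Lemma bounded_variation_grid (f : R -> R) : bounded_variation 0 1 f ->
  exists B, forall N, (0 < N)%N ->
    \sum_(k < N) `|f (k.+1%:R / N%:R) - f (k%:R / N%:R)| <= B.
Proof.
move=> [B ubB]; exists B => N N0; have N0R : 0 < N%:R :> R by rewrite ltr0n.
(* A partition lists its points without the left endpoint, so [s] starts at 1/N. *)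
apply: ubB; pose s : seq R := mkseq (fun k => k.+1%:R / N%:R) N.
have szs : size s = N by rewrite size_mkseq.
have nthsS k : (k < N)%N -> nth 1 s k = k.+1%:R / N%:R by exact: nth_mkseq.
clearbody s.
have nths k : (k <= N)%N -> nth 1 (0 :: s) k = k%:R / N%:R.
  by case: k => [_|k kN] /=; [rewrite mul0r|rewrite nthsS].
exists s.
  split.
    apply/(pathP 1) => k; rewrite szs => kN.
    by rewrite nthsS// nths ?(ltnW kN)// ltr_pM2r ?invr_gt0// ltr_nat.
  by rewrite (last_nth 1) szs nths// divff// gt_eqF.
rewrite /variation szs big_mkord; apply: eq_bigr => k _.
by rewrite [LHS]/(`|f (nth 1 s k) - f (nth 1 (0 :: s) k)|) nthsS// nths// ltnW.
Qed.

Section grid.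
Variables j N : nat.
(** One grid step is a quarter period of wave [j], and a whole number of periods of each faster
    wave. *)
Hypothesis NE : N = (4 * freq j)%N.

Let N0R : 0 < N%:R :> R.
Proof. by rewrite NE ltr0n muln_gt0 freq_gt0. Qed.

Let Nneq0 : N%:R != 0 :> R.
Proof. by rewrite gt_eqF. Qed.

(** Phase at the midpoint of the [k]-th cell, where the difference of the cosines at its two ends
    factors. *)
Let phase (l k : nat) : R := 2 * pi * (freq l)%:R * ((k%:R + 1 / 2) / N%:R).

Lemma dvdn_freq l i : (l < i)%N -> (4 * freq l %| freq i)%N.
Proof. by move=> li; rewrite /freq -expnS dvdn_exp2l// ltn_exp2l. Qed.

Lemma dvdn_freq_le l i : (l <= i)%N -> (freq l %| freq i)%N.
Proof. by move=> li; rewrite /freq dvdn_exp2l// leq_exp2l. Qed.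

Lemma wave_grid_const i k : (j < i)%N -> wave i (k%:R / N%:R) = wave i 0 :> R.
Proof.
move=> /dvdn_freq/dvdnP[n]; rewrite -NE => Hn; rewrite /wave; congr (_ * _).
rewrite -[RHS](cosD2pin (n * k)) mulr0 add0r; congr cos.
by rewrite Hn !natrM; field.
Qed.

Lemma lacunary_grid_diff k k' :
  lacunary (k%:R / N%:R) - lacunary (k'%:R / N%:R) =
  wave_sum j.+1 (k%:R / N%:R) - wave_sum j.+1 (k'%:R / N%:R) :> R.
Proof.
have const n a : wave_sum (n + j.+1) (a%:R / N%:R) - wave_sum j.+1 (a%:R / N%:R) =
    wave_sum (n + j.+1) 0 - wave_sum j.+1 0 :> R.
  elim: n => [|n IH]; first by rewrite add0n !subrr.
  rewrite addSn /wave_sum !(big_ord_recr (n + j.+1))/= -!/(wave_sum _ _).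
  by rewrite wave_grid_const ?leq_addl// addrAC IH addrAC.
apply/eqP; rewrite -subr_eq0 -normr_le0; apply/ler_addgt0Pr => e e0.
have e2 : 0 < e / 2 by rewrite divr_gt0.
have [n ne] := freq_inv_small e2; rewrite add0r.
have nn : 2 / (freq (n + j.+1))%:R <= 2 / (freq n)%:R :> R.
  rewrite ler_wpM2l// lef_pV2 ?posrE ?freq_gt0R// ler_nat.
  by apply: leq_freq; exact: leq_addr.
move: (const n k) (const n k').
move: (lacunary_dist (n + j.+1) (k%:R / N%:R : R)) (lacunary_dist (n + j.+1) (k'%:R / N%:R : R)).
set f := lacunary (k%:R / N%:R); set f' := lacunary (k'%:R / N%:R).
set a := wave_sum (n + j.+1) (k%:R / N%:R); set b := wave_sum j.+1 (k%:R / N%:R).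
set a' := wave_sum (n + j.+1) (k'%:R / N%:R); set b' := wave_sum j.+1 (k'%:R / N%:R).
move=> h h' E E'.
have -> : f - f' - (b - b') = (f - a) - (f' - a') by lra.
rewrite (le_trans (ler_normB _ _))//; lra.
Qed.

Let amp (l : nat) : R := - (2 * (coef l / (freq l)%:R) * sin (pi * ((freq l)%:R / N%:R))).

Lemma wave_diff l k :
  wave l (k.+1%:R / N%:R) - wave l (k%:R / N%:R) = amp l * sin (phase l k).
Proof.
rewrite /wave /amp -mulrBr; set u := pi * _.
have -> : 2 * pi * (freq l)%:R * (k.+1%:R / N%:R) = phase l k + u.
  by rewrite /phase /u -[in LHS]natr1; field.
have -> : 2 * pi * (freq l)%:R * (k%:R / N%:R) = phase l k - u.
  by rewrite /phase /u; field.
by rewrite cosD cosB; ring.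
Qed.

(** With [r = freq j / freq l], [N * amp l] is [- 8 * coef l * r * sin (pi / (4 r))], and
    [norm_sinMn] gives [r * |sin (pi / (4 r))| >= sin (pi / 4)]; so 32 is 64 times 1/2. *)
Lemma amp_sqr_ge l : (l <= j)%N -> 32 * l.+1%:R^-1 <= (N%:R * amp l) ^+ 2.
Proof.
move=> /dvdn_freq_le/dvdnP[r Hr].
have l0 := @freq_gt0R R l.
have r0 : 0 < r%:R :> R by rewrite ltr0n; case: r Hr (freq_gt0 j) => // ->.
have rE : (freq l)%:R / N%:R = 1 / (4 * r%:R) :> R.
  by rewrite NE Hr !natrM; field; rewrite !gt_eqF.
have -> : N%:R * amp l = - (8 * coef l * (r%:R * sin (pi * (1 / (4 * r%:R))))).
  by rewrite /amp rE NE Hr !natrM; field; rewrite !gt_eqF.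
rewrite sqrrN exprMn [X in _ <= X * _]exprMn coef_sqr.
have : 1 / 2 <= (r%:R * sin (pi * (1 / (4 * r%:R)))) ^+ 2 :> R.
  have := norm_sinMn r (pi * (1 / (4 * r%:R)) : R).
  have -> : r%:R * (pi * (1 / (4 * r%:R))) = pi / 4 :> R by field; rewrite !gt_eqF.
  rewrite -{1}(gtr0_norm r0) -normrM -ler_sqr ?nnegrE// !real_normK ?num_real//.
  by rewrite sin2cos2 cos_sqr_piquarter; lra.
have : 0 <= l.+1%:R^-1 :> R by rewrite invr_ge0.
set z := _ ^+ 2; set y := _^-1 => y0 hz; nra.
Qed.

Let X (l k : nat) : R := sin (phase l k).
Let Y (l k : nat) : R := cos (phase l k).
Let S (i k : nat) : R := \sum_(i <= l < j.+1) amp l * X l k.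

Lemma phaseD l k s : phase l (k + s) = phase l k + 2 * pi * ((freq l * s)%:R / N%:R).
Proof. by rewrite /phase natrD natrM; field. Qed.

Lemma sinD2pin (n : nat) (x : R) : sin (x + 2 * pi * n%:R) = sin x.
Proof. by rewrite -(periodicn (@sinD2pi R) n x); congr sin; ring. Qed.

Lemma X_periodic l k s : (N %| freq l * s)%N -> X l (k + s) = X l k.
Proof.
move=> /dvdnP[n Hn]; rewrite /X phaseD Hn natrM mulfK ?gt_eqF//.
exact: sinD2pin.
Qed.

Lemma S_periodic i k s : (forall l, (i <= l)%N -> (N %| freq l * s)%N) ->
  S i (k + s) = S i k.
Proof.
by move=> h; apply: eq_big_nat => l /andP[il _]; rewrite X_periodic// h.
Qed.

(** Induction from the fastest sine down: each new sine is slower than all those in [S i.+1], so its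
    quarter period shift leaves them unchanged. *)
Lemma grid_moments n i : (i + n)%N = j.+1 ->
  \sum_(k < N) S i k ^+ 2 = N%:R / 2 * \sum_(i <= l < j.+1) amp l ^+ 2 /\
  N%:R * \sum_(k < N) S i k ^+ 4 <= 3 * (\sum_(k < N) S i k ^+ 2) ^+ 2.
Proof.
elim: n i => [|n IH] i Hi.
  rewrite addn0 in Hi; have S0 k : S i k = 0 by rewrite /S Hi big_geq.
  rewrite Hi big_geq// mulr0 !big1 ?mulr0 ?expr0n/= ?mulr0//.
  - by move=> k _; rewrite -Hi S0 expr0n.
  - by move=> k _; rewrite -Hi S0 expr0n.
rewrite addnS -addSn in Hi; have [IH2 IH4] := IH _ Hi.
have ij : (i < j.+1)%N by rewrite -Hi leq_addr.
have SE k : S i k = amp i * X i k + S i.+1 k by rewrite /S big_ltn.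
have /dvdnP[r Hr] : (freq i %| freq j)%N by exact: dvdn_freq_le.
have XN k : X i (k + N)%N = X i k by apply: X_periodic; exact: dvdn_mull.
have TN k : S i.+1 (k + N)%N = S i.+1 k.
  by apply: S_periodic => l _; exact: dvdn_mull.
(* Since [r = freq j / freq i], [r] grid steps make a quarter period of wave [i]. *)
have quarter : 2 * pi * ((freq i * r)%:R / N%:R) = pi / 2 :> R.
  by rewrite mulnC -Hr NE natrM; field; rewrite gt_eqF// freq_gt0R.
have Xs k : X i (k + r)%N = Y i k by rewrite /X phaseD quarter sinDpihalf.
have Ys k : Y i (k + r)%N = - X i k by rewrite /Y phaseD quarter cosDpihalf.
have XY k : X i k ^+ 2 + Y i k ^+ 2 = 1 by rewrite addrC cos2Dsin2.
have Ts k : S i.+1 (k + r)%N = S i.+1 k.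
  apply: S_periodic => l il; have /dvdnP[q ->] := dvdn_freq il.
  by rewrite NE Hr -mulnA dvdn_mull// -mulnA [(r * _)%N]mulnC.
have E2 := second_moment_step (amp i) XN TN Xs Ys XY Ts.
have E4 := fourth_moment_step (amp i) XN TN Xs Ys XY Ts.
have SEn p : \sum_(k < N) S i k ^+ p = \sum_(k < N) (amp i * X i k + S i.+1 k) ^+ p.
  by apply: eq_bigr => k _; rewrite SE.
rewrite !SEn E2 IH2 (big_ltn ij); split; first by field.
rewrite -IH2; apply: (le_trans (ler_wpM2l (ltW N0R) E4)).
move: IH4; set A := \sum_(k < N) S i.+1 k ^+ 2; set D := \sum_(k < N) S i.+1 k ^+ 4 => IH4.
(* A quarter of this square is the slack left in the inductive inequality. *)
have : 0 <= (N%:R * amp i ^+ 2) ^+ 2 by exact: sqr_ge0.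
set c := amp i; set M := N%:R.
have -> : c ^+ 4 = c ^+ 2 * c ^+ 2 by ring.
rewrite !expr2; lra.
Qed.

(** [N] times the second moment is half the sum of the [(N * amp l)^2], so at least 16 times the
    harmonic sum, and [first_moment_ge] bounds it by 64 times the squared variation. *)
Lemma lacunary_grid_variation :
  \sum_(l < j.+1) l.+1%:R^-1 <=
  4 * (\sum_(k < N) `|lacunary (k.+1%:R / N%:R) - lacunary (k%:R / N%:R)|) ^+ 2 :> R.
Proof.
have [S2 S4] := grid_moments (add0n j.+1).
have N0 : (0 < N)%N by rewrite -(ltr0n R).
have := first_moment_ge N0 S4; rewrite S2 big_mkord.
have -> : \sum_(k < N) `|S 0 k| =
    \sum_(k < N) `|lacunary (k.+1%:R / N%:R) - lacunary (k%:R / N%:R)|.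
  apply: eq_bigr => k _; congr `| _ |; rewrite lacunary_grid_diff /wave_sum -sumrB.
  by rewrite /S big_mkord; apply: eq_bigr => l _; rewrite wave_diff.
set L := _ ^+ 2.
have -> : N%:R * (N%:R / 2 * \sum_(l < j.+1) amp l ^+ 2) =
    (\sum_(l < j.+1) (N%:R * amp l) ^+ 2) / 2.
  rewrite mulrA mulr_sumr mulr_suml; apply: eq_bigr => l _; by field.
have : 32 * \sum_(l < j.+1) l.+1%:R^-1 <= \sum_(l < j.+1) (N%:R * amp l) ^+ 2.
  by rewrite mulr_sumr; apply: ler_sum => l _; apply: amp_sqr_ge; rewrite -ltnS.
lra.
Qed.

End grid.

Lemma lacunary_unbounded_variation : ~ bounded_variation 0 1 (@lacunary R).
Proof.
move=> /bounded_variation_grid[B hB].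
apply: (@dvg_harmonic R); apply: nondecreasing_is_cvgn.
  by apply: nondecreasing_series => n _ _; rewrite /harmonic invr_ge0.
exists (4 * B ^+ 2) => _ [n _ <-].
have N0 : (0 < 4 * freq n)%N by rewrite muln_gt0 freq_gt0.
have L0 : 0 <= \sum_(k < 4 * freq n) `|lacunary (k.+1%:R / (4 * freq n)%:R) -
  lacunary (k%:R / (4 * freq n)%:R)| :> R by apply: sumr_ge0.
(* The harmonic partial sum has [n] terms, the grid bound [n.+1]. *)
apply: (@le_trans _ _ (\sum_(l < n.+1) l.+1%:R^-1)).
  by rewrite /series/= big_mkord big_ord_recr/= lerDl invr_ge0.
apply: (le_trans (lacunary_grid_variation (erefl (4 * freq n)%N))); rewrite ler_wpM2l//.
by rewrite ler_sqr ?nnegrE ?hB// (le_trans L0)// hB.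
Qed.

End unbounded_variation.

Theorem theorem1 (R : realType) :
  exists f : R -> R,
    [/\ continuous f,
        periodic f 1,
        ~ bounded_variation 0 1 f &
        forall theta phi : R, irrational theta ->
          limn_einf (fun Q : nat =>
            (`| \sum_(0 <= k < Q) f (k%:R * theta + phi) |)%:E) = 0%E].
Proof.
exists lacunary; split.
- exact: continuous_lacunary.
- exact: periodic_lacunary.
- exact: lacunary_unbounded_variation.
- by move=> theta phi; exact: lacunary_liminf.
Qed.
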